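(* Let $\omega$ be a concave modulus of continuity and write $$\eta = \lim_{t \to 0} \frac{\log\omega(t)}{\log t}$$ (this limit exists because $\omega$ is concave). Then: (i) If $\eta \geq 1$, then $\dim_{\mathrm{qA}} G_f = 1$ for all $f \in C^\omega[0,1]$. (ii) If $\eta < 1$, then a typical $f \in (c^\omega[0,1], \|\cdot\|_\omega)$ satisfies $\dim_{\mathrm{qA}} G_f = 2$.
   Context: A modulus of continuity is a function $\omega:[0,1]\to[0,\infty]$ that is increasing (meaning non-decreasing), satisfies $\omega(t)>0$ for $t>0$, and $\lim_{t\to 0}\omega(t)=\omega(0)=0$. For $f:[0,1]\to\mathbb{R}$ put $[f]_\omega=\sup_{x,y\in[0,1],\,x\neq y}\frac{|f(x)-f(y)|}{\omega(|x-y|)}$ and $\|f\|_\omega=\|f\|_\infty+[f]_\omega$. Let $C^\omega[0,1]=\{f:[0,1]\to\mathbb{R} : [f]_\omega<\infty\}$, and let $c^\omega[0,1]$ (the little $\omega$-space) be the set of all $f\in C^\omega[0,1]$ with $\lim_{t\to0}\sup\{\frac{|f(x)-f(y)|}{\omega(|x-y|)} : x,y\in[0,1],\ x\neq y,\ |x-y|\leq t\}=0$. Both are complete metric spaces under $\|\cdot\|_\omega$. In a complete metric space, a set is meagre if it is a countable union of nowhere dense sets, and residual if its complement is meagre; a typical element has a property if the set of elements having it is residual. $G_f=\{(x,f(x)) : x\in[0,1]\}\subseteq\mathbb{R}^2$ is the graph of $f$. For non-empty $E\subseteq\mathbb{R}^d$ and $r>0$, $N_r(E)$ is the maximum number of pairwise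 disjoint closed balls of radius $r$ with centres in $E$. $B^o(x,R)$ is the open ball of radius $R$ centred at $x$. For $\theta\in(0,1)$ the Assouad spectrum of a non-empty $F\subseteq\mathbb{R}^d$ is $$\dim_{\mathrm{A}}^{\theta}F=\inf\{\beta : \exists\, C>0 \text{ such that for all } 0<r<1 \text{ and } x\in F,\ N_r(B^o(x,r^\theta)\cap F)\leq C(r^\theta/r)^\beta\}.$$ The quasi-Assouad dimension is $\dim_{\mathrm{qA}}F=\lim_{\theta\to1}\dim_{\mathrm{A}}^{\theta}F$.
   Formalization: The existence of the limit η is assumed rather than derived from concavity: for some concave moduli log ω(t)/log t oscillates as t → 0, so η is undefined; the theorem covers every concave ω for which the limit exists. *)

(* Defs.v *)
From HB Require Import structures.
From mathcomp Require Import all_boot all_order all_algebra finmap.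
From mathcomp Require Import interval_inference.
From mathcomp Require Import all_classical all_reals all_analysis.
From mathcomp Require Import ring lra.

Set Implicit Arguments.
Unset Strict Implicit.
Unset Printing Implicit Defensive.
Import Order.TTheory GRing.Theory Num.Theory.
Import numFieldNormedType.Exports.
Local Open Scope classical_set_scope.
Local Open Scope ring_scope.

(* The space [0,1] is the library type {i01 R}.  A modulus of continuity is   *)
(* a total function on R of which only the values on [0,1] are ever used.     *)

Record is_modulus (R : realType) (omega : R -> \bar R) : Prop := IsModulus {
  modulus_ge0 : forall t, 0 <= t <= 1 -> (0 <= omega t)%E ;
  modulus_homo : forall s t, 0 <= s -> s <= t -> t <= 1 ->
    (omega s <= omega t)%E ;
  modulus_gt0 : forall t, 0 < t <= 1 -> (0 < omega t)%E ;
  modulus0 : omega 0 = 0%E ;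
  modulus_cvg0 : omega t @[t --> 0^'+] --> 0%E }.

Record modulus (R : realType) := Modulus {
  modulus_fun :> R -> \bar R ;
  modulusP : is_modulus modulus_fun }.

Definition concave01 (R : realType) (omega : R -> \bar R) : Prop :=
  forall s x y : R, 0 <= s <= 1 -> 0 <= x <= 1 -> 0 <= y <= 1 ->
    (s%:E * omega x + (1 - s)%:E * omega y <= omega (s * x + (1 - s) * y)%R)%E.

Section holder_spaces.
Context {R : realType}.
Implicit Types (omega : R -> \bar R) (f g : {i01 R} -> R).

(* The library's extended division gives a / +oo = 0. *)
Definition diff_quot omega f (x y : {i01 R}) : \bar R :=
  (`|f x - f y|%:E / omega `|x%:num - y%:num|%R)%E.

Definition holder_seminorm omega f : \bar R :=
  ereal_sup [set diff_quot omega f xy.1 xy.2 |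
             xy in [set xy : {i01 R} * {i01 R} | xy.1 != xy.2]].

Definition local_holder_seminorm omega f (t : R) : \bar R :=
  ereal_sup [set diff_quot omega f xy.1 xy.2 |
             xy in [set xy : {i01 R} * {i01 R} |
                    xy.1 != xy.2 /\ `|xy.1%:num - xy.2%:num| <= t]].

Definition sup_norm f : \bar R := ereal_sup (range (fun x => `|f x|%:E)).

Definition holder_norm omega f : \bar R :=
  (sup_norm f + holder_seminorm omega f)%E.

Definition holder_space omega : set ({i01 R} -> R) :=
  [set f | (holder_seminorm omega f < +oo)%E].

Definition little_holder_space omega : set ({i01 R} -> R) :=
  [set f | holder_space omega f /\
           local_holder_seminorm omega f t @[t --> 0^'+] --> 0%E].

End holder_spaces.

Definition little_holder (R : realType) (omega : modulus R) : Type :=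
  set_type (little_holder_space omega).

Section little_holder_metric.
Context {R : realType} (omega : modulus R).
Implicit Types (f g h : {i01 R} -> R).

Lemma modulus_dist_gt0 (x y : {i01 R}) : x != y ->
  (0 < omega `|x%:num - y%:num|%R)%E.
Proof.
move=> xy; apply: (modulus_gt0 (modulusP omega)).
have x0 : 0 <= x%:num by []. have x1 : x%:num <= 1 by [].
have y0 : 0 <= y%:num by []. have y1 : y%:num <= 1 by [].
rewrite normr_gt0 subr_eq0; apply/andP; split.
  by apply: contra xy => /eqP xy; apply/eqP/val_inj.
by rewrite ler_norml; lra.
Qed.

Lemma diff_quot_ge0 f (x y : {i01 R}) : x != y -> (0 <= diff_quot omega f x y)%E.
Proof.
move=> xy; apply: mule_ge0; first by rewrite lee_fin.
by rewrite inve_ge0 ltW// modulus_dist_gt0.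
Qed.

Let i0 : {i01 R} := 0%:i01.
Let i1 : {i01 R} := 1%:i01.
Let i01_neq : i0 != i1.
Proof. by rewrite -val_eqE /= eq_sym oner_eq0. Qed.

Lemma diff_quot_le_seminorm f (x y : {i01 R}) : x != y ->
  (diff_quot omega f x y <= holder_seminorm omega f)%E.
Proof. by move=> xy; apply: ereal_sup_ubound; exists (x, y). Qed.

Lemma holder_seminorm_ge0 f : (0 <= holder_seminorm omega f)%E.
Proof.
by apply: (le_trans (diff_quot_ge0 f i01_neq)); exact: diff_quot_le_seminorm.
Qed.

Lemma sup_norm_ge f x : (`|f x|%:E <= sup_norm f)%E.
Proof. by apply: ereal_sup_ubound; exists x. Qed.

Lemma sup_norm_ge0 f : (0 <= sup_norm f)%E.
Proof. by apply: le_trans (sup_norm_ge f i0); rewrite lee_fin. Qed.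

Lemma holder_norm_ge0 f : (0 <= holder_norm omega f)%E.
Proof. by rewrite adde_ge0 ?sup_norm_ge0 ?holder_seminorm_ge0. Qed.

Lemma diff_quot_triangle f g h x y : x != y ->
  (diff_quot omega (fun z => f z - h z)%R x y <=
   diff_quot omega (fun z => f z - g z)%R x y +
   diff_quot omega (fun z => g z - h z)%R x y)%E.
Proof.
move=> xy; rewrite /diff_quot -ge0_muleDl ?lee_fin//.
apply: lee_wpmul2r; first by rewrite inve_ge0 ltW// modulus_dist_gt0.
rewrite -EFinD lee_fin.
have -> : f x - h x - (f y - h y) =
  (f x - g x - (f y - g y)) + (g x - h x - (g y - h y)) by ring.
exact: ler_normD.
Qed.

Lemma holder_norm_triangle f g h :
  (holder_norm omega (fun z => f z - h z)%R <=
   holder_norm omega (fun z => f z - g z)%R +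
   holder_norm omega (fun z => g z - h z)%R)%E.
Proof.
rewrite /holder_norm addeACA; apply: leeD.
  apply: ge_ereal_sup => _ [x _ <-].
  apply: (le_trans _ (leeD (sup_norm_ge _ x) (sup_norm_ge _ x))).
  rewrite -EFinD lee_fin.
  have -> : f x - h x = (f x - g x) + (g x - h x) by ring.
  exact: ler_normD.
apply: ge_ereal_sup => _ [[x y] /= xy <-].
apply: (le_trans (diff_quot_triangle f g h xy)).
by apply: leeD; exact: diff_quot_le_seminorm.
Qed.

Lemma holder_normB f g : holder_norm omega (fun z => f z - g z)%R =
  holder_norm omega (fun z => g z - f z)%R.
Proof.
rewrite /holder_norm /sup_norm /holder_seminorm; congr (_ + ereal_sup _)%E.
  by congr ereal_sup; apply: eq_imagel => x _; rewrite distrC.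
apply: eq_imagel => -[x y] _ /=; rewrite /diff_quot; congr (_%:E / _)%E.
have -> : f x - g x - (f y - g y) = - (g x - f x - (g y - f y)) by ring.
by rewrite normrN.
Qed.

Lemma holder_spaceB f g : holder_space omega f -> holder_space omega g ->
  holder_space omega (fun z => f z - g z)%R.
Proof.
rewrite /holder_space /= => ff gf.
apply: (@le_lt_trans _ _ (holder_seminorm omega f + holder_seminorm omega g)%E);
  last exact: lte_add_pinfty.
apply: ge_ereal_sup => _ [[x y] /= xy <-].
apply: le_trans (leeD (diff_quot_le_seminorm f xy) (diff_quot_le_seminorm g xy)).
rewrite /diff_quot -ge0_muleDl ?lee_fin//.
apply: lee_wpmul2r; first by rewrite inve_ge0 ltW// modulus_dist_gt0.
rewrite -EFinD lee_fin.
have -> : f x - g x - (f y - g y) = (f x - f y) - (g x - g y) by ring.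
exact: ler_normB.
Qed.

Lemma modulus_fin_near0 : exists2 d : R, 0 < d <= 1 & (omega d < +oo)%E.
Proof.
have /fine_cvgP[A _] := modulus_cvg0 (modulusP omega).
near (0:R)^'+ => t; exists t.
  have t0 : 0 < t by []; rewrite t0 /=.
  by near: t; apply: nbhs_right_le.
have: omega t \is a fin_num by near: t.
by rewrite fin_numE => /andP[_]; rewrite ltey.
Unshelve. all: by end_near. Qed.

Lemma holder_step f (d : R) : 0 < d <= 1 -> (omega d < +oo)%E ->
  holder_space omega f -> exists2 M : R, 0 <= M &
  forall x y : {i01 R}, `|x%:num - y%:num| <= d -> `|f x - f y| <= M.
Proof.
move=> /andP[d0 d1] od ff.
have s0 := holder_seminorm_ge0 f.
have o0 : (0 <= omega d)%E.
  by apply: (modulus_ge0 (modulusP omega)); rewrite ltW.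
exists (fine (holder_seminorm omega f) * fine (omega d)).
  by rewrite mulr_ge0// fine_ge0.
move=> x y xyd; have [->|xy] := eqVneq x y.
  by rewrite subrr normr0 mulr_ge0// fine_ge0.
have := diff_quot_le_seminorm f xy.
have ow : (omega `|x%:num - y%:num|%R <= omega d)%E.
  exact: (modulus_homo (modulusP omega)).
have := modulus_dist_gt0 xy.
move: ow; rewrite /diff_quot.
move: (omega _) => [w| |]//; last by move: od => /[swap] /le_lt_trans/[apply].
move: (omega d) o0 od => [e| |]// _ _.
have sf : (holder_seminorm omega f < +oo)%E := ff.
move: (holder_seminorm omega f) s0 sf => [s| |]// s0 _.
rewrite !lee_fin lte_fin in s0 * => we w0.
rewrite inver gt_eqF// -EFinM lee_fin ler_pdivrMr// => H.
by apply: (le_trans H) => /=; rewrite ler_wpM2l.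
Qed.

Lemma holder_sup_norm_fin f : holder_space omega f -> (sup_norm f < +oo)%E.
Proof.
move=> ff; have [d dP od] := modulus_fin_near0.
have [M M0 HM] := holder_step dP od ff; have /andP[d0 d1] := dP.
have chain n (x : {i01 R}) : x%:num <= n%:R * d -> `|f x - f i0| <= n%:R * M.
  elim: n x => [|n IH] x xn.
    have -> : x = i0.
      by apply/val_inj/eqP; rewrite /= eq_le; rewrite mul0r in xn; rewrite xn /=.
    by rewrite subrr normr0 mul0r.
  have x0 : 0 <= x%:num by []. have x1 : x%:num <= 1 by [].
  have [xd|dx] := leP x%:num d.
    apply: (@le_trans _ _ M).
      by apply: HM; rewrite /= subr0 ger0_norm.
    by rewrite ler_peMl// ler1n.
  have y0 : 0 <= x%:num - d by lra.
  have y1 : x%:num - d <= 1 by lra.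
  pose y : {i01 R} := Itv01 y0 y1.
  have -> : f x - f i0 = (f y - f i0) + (f x - f y) by ring.
  apply: (le_trans (ler_normD _ _)).
  rewrite -natr1 mulrDl mul1r lerD//.
    by apply: IH; rewrite /= lerBlDr -[X in _ + X]mul1r -mulrDl natr1.
  apply: HM => /=; have -> : x%:num - (x%:num - d) = d by ring.
  by rewrite ger0_norm// ltW.
have [n nd] : exists n : nat, 1 <= n%:R * d.
  exists (Num.bound d^-1).
  rewrite -ler_pdivrMr// div1r ltW//.
  by apply: archi_boundP; rewrite invr_ge0 ltW.
apply: (@le_lt_trans _ _ (n%:R * M + `|f i0|)%:E); last by rewrite ltry.
apply: ge_ereal_sup => _ [x _ <-]; rewrite lee_fin.
have -> : f x = (f x - f i0) + f i0 by ring.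
apply: (le_trans (ler_normD _ _)); rewrite lerD2r.
by apply: chain; apply: le_trans nd.
Qed.

Lemma holder_norm_fin f : holder_space omega f ->
  holder_norm omega f \is a fin_num.
Proof.
move=> ff; rewrite ge0_fin_numE ?holder_norm_ge0//.
by apply: lte_add_pinfty => //; exact: holder_sup_norm_fin.
Qed.

Definition little_holder_dist (f g : little_holder omega) : R :=
  fine (holder_norm omega (fun x => val f x - val g x)).

Lemma little_holder_normB_fin (f g : little_holder omega) :
  holder_norm omega (fun x => val f x - val g x) \is a fin_num.
Proof.
apply: holder_norm_fin; apply: holder_spaceB.
  by have := valP f; rewrite inE => -[].
by have := valP g; rewrite inE => -[].
Qed.

Lemma little_holder_distxx (f : little_holder omega) : little_holder_dist f f = 0.
Proof.
suff H : holder_norm omega (fun x => val f x - val f x) = 0%E.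
  by rewrite /little_holder_dist H.
apply/eqP; rewrite eq_le holder_norm_ge0 andbT -[leRHS]adde0; apply: leeD.
  by apply: ge_ereal_sup => _ [x _ <-]; rewrite subrr normr0.
apply: ge_ereal_sup => _ [[x y] _ <-] /=.
by rewrite /diff_quot !subrr normr0 mul0e.
Qed.

Lemma little_holder_dist_eq0 (f g : little_holder omega) :
  little_holder_dist f g = 0 -> f = g.
Proof.
rewrite /little_holder_dist => H; apply/val_inj/funext => x.
apply/eqP; rewrite -subr_eq0 -normr_le0 -lee_fin -H.
rewrite fineK ?little_holder_normB_fin//.
apply: (le_trans (sup_norm_ge (fun x => val f x - val g x) x)).
by rewrite leeDl// holder_seminorm_ge0.
Qed.

Lemma little_holder_dist_sym (f g : little_holder omega) :
  little_holder_dist f g = little_holder_dist g f.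
Proof. by rewrite /little_holder_dist holder_normB. Qed.

Lemma little_holder_dist_triangle (g f h : little_holder omega) :
  little_holder_dist f h <= little_holder_dist f g + little_holder_dist g h.
Proof.
rewrite /little_holder_dist -fineD ?little_holder_normB_fin//.
apply: fine_le; first exact: little_holder_normB_fin.
  by rewrite fin_numD; apply/andP; split; exact: little_holder_normB_fin.
exact: (holder_norm_triangle (val f) (val g) (val h)).
Qed.

HB.instance Definition _ := Choice.on (little_holder omega).
HB.instance Definition _ := isMetric.Build R (little_holder omega)
  little_holder_distxx little_holder_dist_eq0 little_holder_dist_sym
  little_holder_dist_triangle.

End little_holder_metric.

Section category.
Context {T : topologicalType}.
Implicit Type A : set T.

Definition nowhere_dense A := (closure A)° = set0.

Definition meagre A := exists2 N : (set T)^nat,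
  (forall n, nowhere_dense (N n)) & A = \bigcup_n N n.

Definition residual A := meagre (~` A).

Definition typical (P : T -> Prop) := residual [set x | P x].

End category.

Section dimensions.
Context {R : realType} {d : nat}.
Implicit Types (x y : 'rV[R]_d) (E F : set 'rV[R]_d) (r theta : R).

(* The library's norm and balls on 'rV[R]_d are those of the maximum norm. *)
Definition euclidean_dist x y : R :=
  Num.sqrt (\sum_(i < d) (x ord0 i - y ord0 i) ^+ 2).

Definition open_eball x r : set 'rV[R]_d := [set y | euclidean_dist x y < r].

Definition closed_eball x r : set 'rV[R]_d := [set y | euclidean_dist x y <= r].

(* N_r(E), the value +oo being allowed for unbounded E *)
Definition packing_number r E : \bar R :=
  ereal_sup [set (#|` S|%:R : R)%:E | S in [set S : {fset 'rV[R]_d} |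
    [set` S] `<=` E /\ trivIset [set` S] (closed_eball ^~ r)]].

Definition assouad_spectrum theta F : \bar R :=
  ereal_inf [set beta%:E | beta in [set beta : R |
    exists2 C : R, 0 < C & forall r x, 0 < r < 1 -> F x ->
      (packing_number r (open_eball x (r `^ theta) `&` F) <=
       (C * (r `^ theta / r) `^ beta)%:E)%E]].

(* lim returns 0 when the limit does not exist *)
Definition quasi_assouad_dim F : \bar R :=
  lim (assouad_spectrum theta F @[theta --> 1^'-]).

End dimensions.

Definition graph (R : realType) (f : {i01 R} -> R) : set 'rV[R]_2 :=
  range (fun x : {i01 R} => \row_(j < 2) (if j == ord0 then x%:num else f x)).

(* Main.v *)
Require Import Defs.
From mathcomp Require Import all_boot all_order all_algebra finmap.
From mathcomp Require Import interval_inference.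
From mathcomp Require Import all_classical all_reals all_analysis.
From mathcomp Require Import ring lra.
Set Implicit Arguments.
Unset Strict Implicit.
Unset Printing Implicit Defensive.
Import Order.TTheory GRing.Theory Num.Theory.
Import numFieldNormedType.Exports.
Local Open Scope classical_set_scope.
Local Open Scope ring_scope.

(* Cutting a ball of radius [r^theta] into columns of width about [r] bounds a
   packing by the number of grid cells met. In (i) [f] is [a]-Hoelder for every
   [a < 1], so each of the about [r^theta / r] columns meets at most about
   [r^(a-1)] cells; the lower bound comes from points sampled along the graph.

   For (ii), fix [eta < a < ts < 1], so that [t^a <= omega t] near [0]. A function
   of the little space can be frozen to a constant on a short interval [0, delta]
   at a small cost in norm, precisely because its local seminorm tends to 0. Adding
   a wave of wavelength about [r] and amplitude about [omega r >> r^ts] also costs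
   little, by concavity of [omega], and it survives small uniform perturbations:
   above every interval [k r, (k+1) r] within [0, r^ts] the graph then meets all
   heights of a window of half-width [r^ts]. So a typical [f] has this property for
   arbitrarily small [r]. One and the same [r] serves all [theta] in [ts, 1): some
   ball of radius [r^theta] packs about [(r^theta / r)^2] balls of radius [r], so
   the Assouad spectrum is 2 on the whole of [ts, 1) and no continuity in [theta] is
   needed. *)

(** * Powers of small numbers and points of the unit interval *)

Lemma powR_lt_near0 (R : realType) (a e : R) : 0 < a -> 0 < e ->
  exists2 r0 : R, 0 < r0 & forall r, 0 < r -> r < r0 -> r `^ a < e.
Proof.
move=> a0 e0; exists (e `^ a^-1); first exact: powR_gt0.
move=> r r0 rl.
have -> : e = (e `^ a^-1) `^ a by rewrite -powRrM mulVf ?gt_eqF// powRr1// ltW.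
by apply: gt0_ltr_powR rl => //; rewrite nnegrE ?powR_ge0// ltW.
Qed.

Lemma powRD_gt0 (R : realType) (r a b : R) : 0 < r ->
  r `^ (a + b) = r `^ a * r `^ b.
Proof. by move=> r0; rewrite powRD// (gt_eqF r0) ?implybT. Qed.

Lemma powRB_gt0 (R : realType) (r a b : R) : 0 < r ->
  r `^ (a - b) = r `^ a / r `^ b.
Proof. by move=> r0; rewrite powRB// (gt_eqF r0) ?implybT. Qed.

Lemma powR_div_self (R : realType) (r a : R) : 0 < r ->
  r `^ a / r = r `^ (a - 1).
Proof. by move=> r0; rewrite powRB_gt0// powRr1// ltW. Qed.

Lemma i01_val_inj (R : realType) (x y : {i01 R}) : x%:num = y%:num -> x = y.
Proof. by move=> xy; apply/val_inj. Qed.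

Lemma i01_itv (R : realType) (x : {i01 R}) : 0 <= x%:num <= 1.
Proof. by have -> /= : 0 <= x%:num by []. Qed.

Lemma i01_dist (R : realType) (x y : {i01 R}) :
  0 <= `|x%:num - y%:num| <= 1.
Proof.
rewrite normr_ge0 /= ler_norml.
by have := i01_itv x; have := i01_itv y; lra.
Qed.

Lemma i01_dist_gt0 (R : realType) (x y : {i01 R}) : x != y ->
  0 < `|x%:num - y%:num|.
Proof.
by move=> xy; rewrite normr_gt0 subr_eq0; apply: contra xy => /eqP/i01_val_inj/eqP.
Qed.

(** * Concave moduli and Hoelder estimates with real values *)

Section concave_modulus.
Context {R : realType} {omega : modulus R} (omega_concave : concave01 omega).

(** The modulus is finite at some [d > 0]. For [t > d], concavity on the chord from [0] to [t] gives
    [(d / t) * omega t <= omega d], which rules out [+oo]. *)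
Lemma modulus_fin_num t : 0 <= t <= 1 -> omega t \is a fin_num.
Proof.
move=> t01; have [t0 t1] := andP t01.
rewrite ge0_fin_numE ?(modulus_ge0 (modulusP omega))//.
have [d /andP[d0 d1] od] := modulus_fin_near0 omega.
have [td|dt] := leP t d.
  by apply: le_lt_trans od; exact: (modulus_homo (modulusP omega)).
have t_gt0 : 0 < t by exact: lt_trans dt.
have s01 : 0 <= d / t <= 1.
  by rewrite divr_ge0 ?(ltW d0)//= ler_pdivrMr// mul1r ltW.
have /(_ _) := omega_concave s01 t01 (_ : 0 <= (0 : R) <= 1).
rewrite lexx ler01 => /(_ isT).
rewrite (modulus0 (modulusP omega)) mule0 adde0 mulr0 addr0.
rewrite divfK ?gt_eqF// => H.
rewrite ltey; apply/eqP => ty; move: H; rewrite ty gt0_muley ?leye_eq.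
  by move=> /eqP dy; move: od; rewrite dy ltxx.
by rewrite lte_fin divr_gt0.
Qed.

Let w t := fine (omega t).

Lemma modulus_fineK t : 0 <= t <= 1 -> omega t = (w t)%:E.
Proof. by move=> t01; rewrite fineK// modulus_fin_num. Qed.

Lemma fine_modulus_ge0 t : 0 <= t <= 1 -> 0 <= w t.
Proof. by move=> t01; rewrite fine_ge0// (modulus_ge0 (modulusP omega)). Qed.

Lemma fine_modulus_gt0 t : 0 < t <= 1 -> 0 < w t.
Proof.
move=> /andP[t0 t1]; rewrite -lte_fin -modulus_fineK ?(ltW t0)//.
by apply: (modulus_gt0 (modulusP omega)); rewrite t0.
Qed.

Lemma fine_modulus_homo s t : 0 <= s -> s <= t -> t <= 1 -> w s <= w t.
Proof.
move=> s0 st t1; rewrite -lee_fin -!modulus_fineK ?s0 ?t1 ?(le_trans s0 st)//.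
  exact: (modulus_homo (modulusP omega)).
exact: le_trans t1.
Qed.

(** Concavity on a chord starting at [omega 0 = 0]: the slope [w t / t] does not increase with
    [t]. *)
Lemma fine_modulus_ratio s r : 0 <= s -> s <= r -> 0 < r <= 1 ->
  s / r * w r <= w s.
Proof.
move=> s0 sr /andP[r0 r1].
have s01 : 0 <= s / r <= 1.
  by rewrite divr_ge0 ?(ltW r0)//= ler_pdivrMr// mul1r.
have r01 : 0 <= r <= 1 by rewrite ltW.
have /(_ _) := omega_concave s01 r01 (_ : 0 <= (0 : R) <= 1).
rewrite lexx ler01 => /(_ isT).
rewrite (modulus0 (modulusP omega)) mule0 adde0 mulr0 addr0.
rewrite divfK ?gt_eqF// !modulus_fineK//.
by rewrite s0 (le_trans sr).
Qed.

Lemma diff_quotE f (x y : {i01 R}) : x != y ->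
  diff_quot omega f x y = (`|f x - f y| / w `|x%:num - y%:num|)%:E.
Proof.
move=> xy; rewrite /diff_quot modulus_fineK ?i01_dist// inver gt_eqF ?EFinM//.
by apply: fine_modulus_gt0; rewrite i01_dist_gt0//=; case/andP: (i01_dist x y).
Qed.

Lemma diff_quot_leP f (x y : {i01 R}) (M : R) : x != y ->
  (diff_quot omega f x y <= M%:E)%E =
  (`|f x - f y| <= M * w `|x%:num - y%:num|).
Proof.
move=> xy; rewrite diff_quotE// lee_fin ler_pdivrMr//.
by apply: fine_modulus_gt0; rewrite i01_dist_gt0//=; case/andP: (i01_dist x y).
Qed.

Lemma holder_seminorm_le f (M : R) :
  (forall x y : {i01 R}, `|f x - f y| <= M * w `|x%:num - y%:num|) ->
  (holder_seminorm omega f <= M%:E)%E.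
Proof.
by move=> fM; apply: ge_ereal_sup => _ [[x y] /= xy <-]; rewrite diff_quot_leP.
Qed.

Lemma holder_spaceP f : holder_space omega f <->
  exists2 M : R, 0 <= M &
  forall x y : {i01 R}, `|f x - f y| <= M * w `|x%:num - y%:num|.
Proof.
split => [ff|[M M0 fM]]; last first.
  by apply: le_lt_trans (ltry M); exact: holder_seminorm_le.
have s0 := holder_seminorm_ge0 omega f.
have sf : holder_seminorm omega f \is a fin_num by rewrite ge0_fin_numE.
exists (fine (holder_seminorm omega f)); first exact: fine_ge0.
move=> x y; have [->|xy] := eqVneq x y.
  rewrite subrr normr0; apply: mulr_ge0; first exact: fine_ge0.
    exact: fine_modulus_ge0 (i01_dist _ _).
by rewrite -diff_quot_leP// fineK// diff_quot_le_seminorm.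
Qed.

(** Replaces the limit of extended-real suprema by an epsilon-delta bound on increments, the form in
    which the perturbations of (ii) are estimated. *)
Lemma little_holder_spaceP f : little_holder_space omega f <->
  holder_space omega f /\ forall e : R, 0 < e -> exists2 d : R, 0 < d <= 1 &
  forall x y : {i01 R}, `|x%:num - y%:num| <= d ->
    `|f x - f y| <= e * w `|x%:num - y%:num|.
Proof.
split=> -[ff H]; split => //; first move=> e e0.
  have /fine_cvgP[Afin /cvgr0Pnorm_lt A] := H.
  near (0:R)^'+ => t; exists t.
    apply/andP; split=> //.
    by near: t; apply: nbhs_right_le.
  have tfin : local_holder_seminorm omega f t \is a fin_num by near: t.
  have te : `|fine (local_holder_seminorm omega f t)| < e.
    by near: t; exact: (A e e0).
  move=> x y xyt; have [->|xy] := eqVneq x y.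
    rewrite subrr normr0; apply: mulr_ge0; first exact: ltW.
      exact: fine_modulus_ge0 (i01_dist _ _).
  rewrite -diff_quot_leP//.
  apply: (@le_trans _ _ (local_holder_seminorm omega f t)).
    by apply: ereal_sup_ubound; exists (x, y).
  rewrite -(fineK tfin) lee_fin; apply: le_trans (ltW te).
  exact: ler_norm.
have bnd e : 0 < e -> \forall t \near (0:R)^'+,
    (0 <= local_holder_seminorm omega f t <= e%:E)%E.
  move=> e0; have [d /andP[d0 d1] fd] := H e e0.
  near=> t; apply/andP; split.
    have t0 : 0 < t by [].
    have t1 : t <= 1 by near: t; apply: nbhs_right_le.
    (* The pair [0], [t] makes the set of quotients non-empty, so its supremum is not [-oo]. *)
    pose y : {i01 R} := Itv01 (ltW t0) t1.
    have xy : (0%:i01 : {i01 R}) != y.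
      by rewrite -val_eqE/= eq_sym gt_eqF.
    apply: (le_trans (diff_quot_ge0 omega f xy)).
    apply: ereal_sup_ubound; exists (0%:i01, y) => //=; split => //.
    by rewrite sub0r normrN gtr0_norm.
  apply: ge_ereal_sup => _ [[x y] /= [xy xyt] <-].
  rewrite diff_quot_leP//; apply: fd; apply: le_trans xyt _.
  by near: t; exact: nbhs_right_ltW.
apply/fine_cvgP; split.
  near=> t; have /andP[l0 l1] : (0 <= local_holder_seminorm omega f t <= 1%:E)%E.
    by near: t; exact: bnd.
  by rewrite ge0_fin_numE//; apply: le_lt_trans l1 (ltry _).
apply/cvgr0Pnorm_le => e e0; near=> t.
have /andP[l0 l1] : (0 <= local_holder_seminorm omega f t <= e%:E)%E.
  by near: t; exact: bnd.
move: l0 l1 => /=; case: (local_holder_seminorm omega f t) => [l| |]//=.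
by rewrite !lee_fin => l0 l1; rewrite ger0_norm.
Unshelve. all: by end_near. Qed.

Lemma little_holder_dist_ge (f g : little_holder omega) x :
  `|val f x - val g x| <= little_holder_dist f g.
Proof.
rewrite -lee_fin fineK ?little_holder_normB_fin//.
apply: le_trans (sup_norm_ge (fun z => val f z - val g z) x) _.
by rewrite leeDl// holder_seminorm_ge0.
Qed.

Lemma little_holder_dist_le (f g : little_holder omega) (a b : R) :
  (forall x, `|val f x - val g x| <= a) ->
  (forall x y : {i01 R}, `|(val f x - val g x) - (val f y - val g y)| <=
     b * w `|x%:num - y%:num|) ->
  little_holder_dist f g <= a + b.
Proof.
move=> fa fb; rewrite -lee_fin fineK ?little_holder_normB_fin// EFinD.
apply: leeD; last exact: holder_seminorm_le.
by apply: ge_ereal_sup => _ [x _ <-]; rewrite lee_fin.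
Qed.

End concave_modulus.

(** * Bounds on packing numbers *)

Lemma norm_coord_le_edist (R : realType) d (x y : 'rV[R]_d) i :
  `|x ord0 i - y ord0 i| <= euclidean_dist x y.
Proof.
rewrite -sqrtr_sqr ler_sqrt; last by apply: sumr_ge0 => k _; exact: sqr_ge0.
by rewrite (bigD1 i)//= lerDl sumr_ge0// => k _; exact: sqr_ge0.
Qed.

Lemma edist2_le (R : realType) (x y : 'rV[R]_2) : euclidean_dist x y <=
  `|x ord0 ord0 - y ord0 ord0| + `|x ord0 ord_max - y ord0 ord_max|.
Proof.
rewrite -[leRHS]ger0_norm ?addr_ge0// -sqrtr_sqr ler_sqrt ?sqr_ge0//.
rewrite big_ord_recl big_ord1.
have -> : lift ord0 ord0 = ord_max :> 'I_2 by exact/val_inj.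
rewrite [leRHS]sqrrD !real_normK ?num_real//.
by rewrite -addrA lerD2l lerDr mulrn_wge0// mulr_ge0.
Qed.

(** A common point of two closed balls would put their centres within [2 * r] in every coordinate.
    The same separation makes [P] injective, so that the packing has [#|T|] members. *)
Lemma le_packing_number (R : realType) d (T : finType) (P : T -> 'rV[R]_d)
    (r : R) (E : set 'rV[R]_d) : 0 <= r -> (forall s, E (P s)) ->
  (forall s t, s != t -> exists i, 2 * r < `|P s ord0 i - P t ord0 i|) ->
  ((#|T|%:R : R)%:E <= packing_number r E)%E.
Proof.
move=> r0 EP sep.
have injP : injective P.
  move=> s t Pst; apply: contrapT => /eqP/sep[i].
  by rewrite Pst subrr normr0; lra.
apply: ereal_sup_ubound => /=.
exists [fset P s | s in T]%fset; last first.
  by rewrite card_imfset//= cardE.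
split => [_ /= /imfsetP[s _ ->]//|].
move=> _ _ /= /imfsetP[s _ ->] /imfsetP[t _ ->] [z [zs zt]].
congr P; apply: contrapT => /eqP/sep[i].
have := le_trans (norm_coord_le_edist _ _ i) zs.
have := le_trans (norm_coord_le_edist _ _ i) zt.
rewrite ltNge !ler_norml => /andP[h1 h2] /andP[h3 h4] /negP; apply; lra.
Qed.

Section grid.
Context {R : realType}.

Lemma eq_truncn_dist (a s u v : R) : 0 < s -> a <= u -> a <= v ->
  Num.truncn ((u - a) / s) = Num.truncn ((v - a) / s) -> `|u - v| < s.
Proof.
move=> s0 au av uv.
have /truncn_itv : 0 <= (u - a) / s by rewrite divr_ge0 ?subr_ge0// ltW.
have /truncn_itv : 0 <= (v - a) / s by rewrite divr_ge0 ?subr_ge0// ltW.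
rewrite -uv; set n := Num.truncn _.
rewrite -(natr1 n) ler_pdivlMr// ltr_pdivrMr// => /andP[h1 h2].
rewrite ler_pdivlMr// ltr_pdivrMr// => /andP[h3 h4].
by rewrite mulrDl mul1r in h2 h4; rewrite ltr_norml; lra.
Qed.

Lemma truncn_lt_grid (a s L u : R) : 0 < s -> a <= u <= a + L ->
  (Num.truncn ((u - a) / s) < (Num.truncn (L / s)).+1)%N.
Proof.
move=> s0 /andP[au uL]; rewrite ltnS le_truncn// ler_pM2r ?invr_gt0//.
by rewrite lerBlDl.
Qed.

(* Two points of an [r]-packing never lie in the same cell of the grid of mesh
   [r / 2] whose [i]-th column is shifted vertically by [phi i]. *)
Lemma packing_number_le (E : set 'rV[R]_2) (r a L H : R) (phi : nat -> R) :
  0 < r -> 0 <= L -> 0 <= H ->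
  (forall p, E p -> a <= p ord0 ord0 <= a + L /\
    `|p ord0 ord_max - phi (Num.truncn ((p ord0 ord0 - a) / (r / 2)))| <= H) ->
  (packing_number r E <= ((L / (r / 2) + 1) * (2 * H / (r / 2) + 1))%:E)%E.
Proof.
move=> r0 L0 H0 EP; have s0 : 0 < r / 2 by rewrite divr_gt0.
apply: ge_ereal_sup => _ [S [SE Striv] <-]; rewrite lee_fin.
pose col (p : 'rV[R]_2) := Num.truncn ((p ord0 ord0 - a) / (r / 2)).
pose bot (p : 'rV[R]_2) := phi (col p) - H.
pose row (p : 'rV[R]_2) := Num.truncn ((p ord0 ord_max - bot p) / (r / 2)).
pose N := Num.truncn (L / (r / 2)); pose M := Num.truncn (2 * H / (r / 2)).
have rowP p : E p -> bot p <= p ord0 ord_max <= bot p + 2 * H.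
  by move=> /EP[_]; rewrite ler_norml /bot /col; lra.
pose g (p : S) : 'I_N.+1 * 'I_M.+1 := (inord (col (val p)), inord (row (val p))).
have SEv (p : S) : E (val p) by apply: SE; exact: (valP p).
have injg : injective g.
  move=> p q [].
  have pE := SEv p; have qE := SEv q.
  have [/andP[p1 p2] _] := EP _ pE; have [/andP[q1 q2] _] := EP _ qE.
  move=> /(congr1 val); rewrite /= !inordK ?truncn_lt_grid ?p1 ?q1// => cpq.
  move=> /(congr1 val); rewrite /= !inordK ?truncn_lt_grid ?rowP// => rpq.
  have hx : `|val p ord0 ord0 - val q ord0 ord0| < r / 2.
    exact: eq_truncn_dist cpq.
  have hy : `|val p ord0 ord_max - val q ord0 ord_max| < r / 2.
    have /andP[bp _] := rowP _ pE; have /andP[bq _] := rowP _ qE.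
    move: rpq bp bq; rewrite /row /bot cpq => rpq bp bq.
    exact: eq_truncn_dist rpq.
  (* Points of one cell are at distance less than [r / 2 + r / 2], so the centre [q] lies in both
     closed balls and disjointness forces [p = q]. *)
  apply: val_inj; apply: Striv; [exact: (valP p)|exact: (valP q)|].
  exists (val q); split => /=.
    by apply: le_trans (edist2_le _ _) _; move: hx hy; lra.
  by apply: le_trans (edist2_le _ _) _; rewrite !subrr normr0 addr0 ltW.
have := leq_card _ injg; rewrite card_prod !card_ord -cardfE => SNM.
have : (#|` S|%:R : R) <= (N.+1 * M.+1)%:R by rewrite ler_nat.
move/le_trans; apply; rewrite natrM -(natr1 N) -(natr1 M); apply: ler_pM.
- by rewrite addr_ge0.
- by rewrite addr_ge0.
- by rewrite lerD2r truncn_le divr_ge0// ltW.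
- by rewrite lerD2r truncn_le divr_ge0// ?mulr_ge0// ltW.
Qed.

End grid.

(** * The Assouad spectrum from packing estimates *)

Section spectrum.
Context {R : realType} {d : nat} (theta : R) (F : set 'rV[R]_d).

Lemma assouad_spectrum_le (b C : R) : 0 < C ->
  (forall r x, 0 < r < 1 -> F x ->
    (packing_number r (open_eball x (r `^ theta) `&` F) <=
     (C * (r `^ theta / r) `^ b)%:E)%E) ->
  (assouad_spectrum theta F <= b%:E)%E.
Proof. by move=> C0 FC; apply: ereal_inf_lbound; exists b => //; exists C. Qed.

(** Arbitrarily small scales suffice: an admissible [beta < b] with constant [C] would give
    [c <= C * r^((1 - theta) * (b - beta))], which fails once [r] is small. *)
Lemma le_assouad_spectrum (b c : R) : theta < 1 -> 0 < c ->
  (forall r0, 0 < r0 -> exists r x, [/\ 0 < r < 1, r < r0, F x &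
    ((c * (r `^ theta / r) `^ b)%:E <=
     packing_number r (open_eball x (r `^ theta) `&` F))%E]) ->
  (b%:E <= assouad_spectrum theta F)%E.
Proof.
move=> t1 c0 FC; apply: le_ereal_inf_tmp => _ [beta [C C0 HC] <-].
rewrite lee_fin leNgt; apply/negP => betab.
have k0 : 0 < (1 - theta) * (b - beta) by rewrite mulr_gt0 ?subr_gt0.
have [r0 r00 rlt] := powR_lt_near0 k0 (divr_gt0 c0 C0).
have [r [x [r01 rr0 Fx cr]]] := FC _ r00.
have /andP[rgt0 _] := r01.
have := le_trans cr (HC r x r01 Fx).
rewrite lee_fin powR_div_self// -!powRrM.
have -> : (theta - 1) * beta = (theta - 1) * b + (1 - theta) * (b - beta).
  by ring.
rewrite (powRD_gt0 _ _ rgt0) mulrCA mulrC ler_pM2l ?powR_gt0// leNgt => /negP; apply.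
by rewrite mulrC -ltr_pdivlMr// rlt.
Qed.

End spectrum.

(** * Clamping to the unit interval, points of a graph and ratios of scales *)

Section clamp.
Context {R : realType}.

Lemma clamp01_ge0 (t : R) : 0 <= Num.max 0 (Num.min t 1).
Proof. by rewrite le_max lexx. Qed.

Lemma clamp01_le1 (t : R) : Num.max 0 (Num.min t 1) <= 1.
Proof. by rewrite ge_max ler01 ge_min lexx orbT. Qed.

(** A 1-Lipschitz retraction of the line, so that functions on [{i01 R}] can be evaluated at any
    real expression. *)
Definition clamp01 (t : R) : {i01 R} := Itv01 (clamp01_ge0 t) (clamp01_le1 t).

Lemma clamp01E (t : R) : 0 <= t <= 1 -> (clamp01 t)%:num = t.
Proof. by move=> /andP[t0 t1] /=; rewrite min_l// max_r. Qed.

Lemma clamp01_num (x : {i01 R}) : clamp01 x%:num = x.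
Proof. by apply: i01_val_inj; rewrite clamp01E// i01_itv. Qed.

Lemma clamp01_dist (s t : R) :
  `|(clamp01 s)%:num - (clamp01 t)%:num| <= `|s - t|.
Proof.
have : - `|s - t| <= s - t <= `|s - t| by rewrite -ler_norml.
rewrite /= ler_norml /Order.max /Order.min.
by do !case: ifPn; rewrite -?leNgt; lra.
Qed.

End clamp.

Section graph_points.
Context {R : realType} (f : {i01 R} -> R).

Definition graph_pt (x : {i01 R}) : 'rV[R]_2 :=
  \row_(j < 2) (if j == ord0 then x%:num else f x).

Lemma graph_pt0 x : graph_pt x ord0 ord0 = x%:num.
Proof. by rewrite mxE. Qed.

Lemma graph_pt1 x : graph_pt x ord0 ord_max = f x.
Proof. by rewrite mxE. Qed.

Lemma graph_ptP x : graph f (graph_pt x).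
Proof. by exists x. Qed.

Lemma edist_graph_pt x y :
  euclidean_dist (graph_pt x) (graph_pt y) <=
  `|x%:num - y%:num| + `|f x - f y|.
Proof. by rewrite -!graph_pt0 -!graph_pt1; exact: edist2_le. Qed.

End graph_points.

Section scale_ratio.
Context {R : realType} (theta r : R).
Hypotheses (theta1 : theta < 1) (r01 : 0 < r < 1).

Lemma powR_ratio (b : R) : (r `^ theta / r) `^ b = r `^ ((theta - 1) * b).
Proof. by have /andP[r0 _] := r01; rewrite powR_div_self// -powRrM. Qed.

Lemma powR_ratio_ge1 : 1 <= r `^ theta / r.
Proof.
have /andP[r0 r1] := r01; rewrite powR_div_self// -[leLHS](powRr0 r).
by apply: ger_powR; rewrite ?r0 ?ltW ?subr_lt0.
Qed.

End scale_ratio.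

Lemma assouad_spectrum_le2 (R : realType) (theta : R) (F : set 'rV[R]_2) :
  theta < 1 -> (assouad_spectrum theta F <= 2%:E)%E.
Proof.
(* The ball lies in a square of side [2 * d], which has at most [(4 * X + 1)^2 <= 25 * X^2] cells,
   where [X = d / r >= 1]. *)
move=> t1; apply: (@assouad_spectrum_le _ _ _ _ _ 25) => // r x r01 Fx.
have /andP[r0 r1] := r01; have X1 := powR_ratio_ge1 t1 r01.
set d := r `^ theta in X1 *; have d0 : 0 < d by exact: powR_gt0.
apply: le_trans (@packing_number_le _ _ r (x ord0 ord0 - d) (2 * d) d
  (fun=> x ord0 ord_max) r0 _ _ _) _; rewrite ?mulr_ge0 ?(ltW d0)//.
  move=> p [xp _]; have := le_lt_trans (norm_coord_le_edist _ _ ord0) xp.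
  have := le_lt_trans (norm_coord_le_edist _ _ ord_max) xp.
  rewrite !ltr_norml => /andP[h1 h2] /andP[h3 h4].
  by split; [lra|rewrite ler_norml; lra].
have -> : 2 * d / (r / 2) = 4 * (d / r) by field; rewrite gt_eqF.
rewrite lee_fin powR_mulrn ?(le_trans _ X1)//.
by move: X1; set X := d / r => X1; nra.
Qed.

(** * Graphs of functions that are [a]-Hoelder for every [a < 1], and limits of spectra *)

Section holder_graph.
Context {R : realType} (f : {i01 R} -> R).
Hypothesis fH : forall a : R, 0 < a < 1 -> exists2 K : R, 0 < K &
  forall x y : {i01 R}, `|f x - f y| <= K * `|x%:num - y%:num| `^ a.

Lemma holder_graph_spectrum_le1 (theta : R) : theta < 1 ->
  (assouad_spectrum theta (graph f) <= 1)%E.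
Proof.
move=> t1; apply/lee_addgt0Pr => e e0; rewrite -EFinD.
pose k := e * (1 - theta); have k0 : 0 < k by rewrite mulr_gt0// subr_gt0.
(* With [1 - a <= k], the [r^(a - 1)] cells of a column cost at most [r^(- k) = (r^theta / r)^e].
   The value [1 / 2] keeps [a] positive when [e] is large. *)
pose a := Num.max (1 - k) (1 / 2).
have a01 : 0 < a < 1.
  by rewrite /a /Order.max; case: ifPn; rewrite -?leNgt; lra.
have ak : - k <= a - 1 by rewrite lerBrDr le_max addrC lexx.
have [K K0 fK] := fH a01.
apply: (@assouad_spectrum_le _ _ _ _ _ (5 * (4 * K + 1))).
  by rewrite mulr_gt0// addr_gt0// mulr_gt0.
move=> r x r01 Fx.
have /andP[r0 r1] := r01; have X1 := powR_ratio_ge1 t1 r01.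
set d := r `^ theta in X1 *; have d0 : 0 < d by exact: powR_gt0.
pose a0 := x ord0 ord0 - d.
(* Column [i] is centred at the height of the graph above its left edge, clamped because the column
   may start outside the unit interval. *)
pose phi (i : nat) := f (clamp01 (a0 + i%:R * (r / 2))).
have s0 : 0 < r / 2 by rewrite divr_gt0.
apply: le_trans (@packing_number_le _ _ r a0 (2 * d) (K * r `^ a)
  phi r0 _ _ _) _; rewrite ?mulr_ge0 ?powR_ge0 ?(ltW d0) ?(ltW K0)//.
  move=> p [/[swap] -[t _ <-] xp].
  have := le_lt_trans (norm_coord_le_edist _ _ ord0) xp.
  rewrite -/(graph_pt f t) graph_pt0 graph_pt1.
  rewrite ltr_norml => /andP[h3 h4]; split; first by rewrite /a0; lra.
  apply: le_trans (fK _ _) _; rewrite ler_wpM2l ?(ltW K0)//.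
  apply: ge0_ler_powR; rewrite ?nnegrE ?(ltW r0)//; first by case/andP: a01 => /ltW.
  rewrite -{1}[t]clamp01_num; apply: le_trans (clamp01_dist _ _) _.
  have /truncn_itv : 0 <= (t%:num - a0) / (r / 2).
    by rewrite divr_ge0// ?(ltW s0)// /a0; lra.
  rewrite -(natr1 (Num.truncn _)) ler_pdivlMr// ltr_pdivrMr//.
  by rewrite (mulrDl _ 1) mul1r ler_norml; lra.
have -> : 2 * d / (r / 2) = 4 * (d / r) by field; rewrite gt_eqF.
have -> : 2 * (K * r `^ a) / (r / 2) = 4 * K * (r `^ a / r).
  by field; rewrite gt_eqF.
have X0 : 0 < d / r by rewrite divr_gt0.
rewrite lee_fin (powRD_gt0 _ _ X0) powRr1 ?(ltW X0)//.
rewrite powR_ratio// (powR_div_self a r0).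
have Y1 : 1 <= r `^ (a - 1).
  rewrite -[leLHS](powRr0 r); apply: ger_powR; rewrite ?r0 ?ltW//.
  by case/andP: a01; lra.
have YZ : r `^ (a - 1) <= r `^ ((theta - 1) * e).
  apply: ger_powR; rewrite ?r0 ?(ltW r1)//; apply: le_trans _ ak.
  by rewrite /k; lra.
(* The two summands [1] of the cell count are absorbed since [d / r] and [r^(a - 1)] are at least
   [1]; this is where [5] and [4 * K + 1] come from. *)
have -> : 5 * (4 * K + 1) * (d / r * r `^ ((theta - 1) * e)) =
   (5 * (d / r)) * ((4 * K + 1) * r `^ ((theta - 1) * e)) by ring.
apply: ler_pM.
- by rewrite addr_ge0// mulr_ge0// ltW.
- by rewrite addr_ge0// !mulr_ge0 ?(ltW K0)// powR_ge0.
- by lra.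
- rewrite [leRHS]mulrDl mul1r; apply: lerD; last exact: le_trans YZ.
  by rewrite ler_wpM2l// mulr_ge0// ltW.
Qed.

(** Points at spacing [3 * r] are sampled over [[0, delta / 2]]. Taking [delta = r^(theta + k)],
    slightly below [r^theta], keeps their heights inside the ball, and it costs only [e] in the
    exponent. *)
Lemma holder_graph_spectrum_ge1 (theta : R) : 0 < theta < 1 ->
  (1 <= assouad_spectrum theta (graph f))%E.
Proof.
move=> /andP[t0 t1]; apply/lee_addgt0Pr => e e0; rewrite -leeBlDr// -EFinB.
pose k := e * (1 - theta); have k0 : 0 < k by rewrite mulr_gt0// subr_gt0.
have tk0 : 0 < theta + k by rewrite addr_gt0.
(* Chosen so that [delta^a = r^theta * r^(k / 2)]. For small [r] the last factor beats [K], and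
   heights vary by at most [r^theta / 4]. *)
pose a := (theta + k / 2) / (theta + k).
have a01 : 0 < a < 1.
  by rewrite divr_gt0 ?addr_gt0 ?divr_gt0//= ltr_pdivrMr// mul1r; lra.
have [K K0 fK] := fH a01.
apply: (@le_assouad_spectrum _ _ _ _ _ (1 / 6)) => // r0 r00.
have [r1 r10 Kr] : exists2 r1 : R, 0 < r1 & forall r, 0 < r -> r < r1 ->
    r `^ (k / 2) < (4 * K)^-1.
  by apply: powR_lt_near0; [rewrite divr_gt0|rewrite invr_gt0 mulr_gt0].
have m0 : 0 < Num.min (Num.min r0 r1) 1 by rewrite !lt_min r00 r10 ltr01.
have [r [rgt0]] : exists r, 0 < r /\ r < Num.min (Num.min r0 r1) 1.
  by exists (Num.min (Num.min r0 r1) 1 / 2); split; lra.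
rewrite !lt_min -andbA => /and3P[rr0 rr1 rlt1].
have r01 : 0 < r < 1 by rewrite rgt0.
exists r, (graph_pt f (clamp01 0)); split => //; first exact: graph_ptP.
pose delta := r `^ (theta + k).
have delta0 : 0 < delta by exact: powR_gt0.
have delta_le : delta <= r `^ theta.
  by apply: ger_powR; rewrite ?rgt0 ?ltW// ltrDl.
have rt1 : r `^ theta <= 1.
  by rewrite -[leRHS](powRr0 r); apply: ger_powR; rewrite ?rgt0 ?ltW.
(* The [n + 1] abscissae [3 * i * r] stay below [delta / 2], while [n + 1 > delta / (6 * r)] gives
   the constant [1 / 6]. *)
pose n := Num.truncn (delta / (6 * r)).
have r6 : 0 < 6 * r by rewrite mulr_gt0.
have /truncn_itv/andP[n1 n2] : 0 <= delta / (6 * r) by rewrite divr_ge0// ltW.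
pose P (i : 'I_n.+1) := graph_pt f (clamp01 (3 * i%:R * r)).
have iP (i : 'I_n.+1) : 0 <= 3 * i%:R * r <= delta / 2.
  rewrite mulr_ge0 ?(ltW rgt0) ?mulr_ge0//=.
  have : (i%:R : R) <= n%:R by rewrite ler_nat -ltnS.
  by move/le_trans => /(_ _ n1); rewrite ler_pdivlMr//; lra.
have c0 : (clamp01 (0 : R))%:num = 0 by apply: clamp01E; rewrite lexx ler01.
have iP1 : forall i : 'I_n.+1, (clamp01 (3 * i%:R * r))%:num = 3 * i%:R * r.
  by move=> i; apply: clamp01E; have /andP[] := iP i; lra.
apply: (@le_trans _ _ ((#|'I_n.+1|%:R : R)%:E)); last first.
  apply: (@le_packing_number _ _ _ P); first exact: ltW.
  - move=> i; split; last exact: graph_ptP.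
    apply: le_lt_trans (edist_graph_pt _ _ _) _.
    have /andP[i0 i1] := iP i.
    have h1 : `|(clamp01 (0 : R))%:num - (clamp01 (3 * i%:R * r))%:num| <= delta / 2.
      by rewrite iP1 c0 sub0r normrN ger0_norm.
    have := fK (clamp01 0) (clamp01 (3 * i%:R * r)).
    have : K * `|(clamp01 (0 : R))%:num - (clamp01 (3 * i%:R * r))%:num| `^ a <=
       K * delta `^ a.
      rewrite ler_wpM2l ?(ltW K0)//; apply: ge0_ler_powR; rewrite ?nnegrE ?(ltW delta0)//.
        by case/andP: a01 => /ltW.
      by apply: le_trans h1 _; lra.
    have -> : delta `^ a = r `^ theta * r `^ (k / 2).
      by rewrite -powRrM -powRD_gt0// /a mulrC divfK// gt_eqF.
    have h2 : K * (r `^ theta * r `^ (k / 2)) <= r `^ theta / 4.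
      have := ltW (Kr _ rgt0 rr1).
      rewrite -(ler_pM2l K0) => h.
      have -> : r `^ theta / 4 = r `^ theta * (K * (4 * K)^-1).
        by field; rewrite gt_eqF.
      by rewrite mulrCA ler_wpM2l// powR_ge0.
    move=> h3 h4; have := lt_le_trans delta0 delta_le; lra.
  - move=> i j ij; exists ord0; rewrite !graph_pt0 !iP1.
    have -> : 3 * i%:R * r - 3 * j%:R * r = 3 * r * (i%:R - j%:R) by ring.
    rewrite normrM gtr0_norm ?mulr_gt0//.
    have : 1 <= `|i%:R - j%:R : R|.
      have [lij|lij|eij] := ltngtP i j; last by move: ij; rewrite -val_eqE/= eij eqxx.
        rewrite distrC ger0_norm ?subr_ge0 ?ler_nat ?(ltnW lij)//.
        by rewrite lerBrDr addrC natr1 ler_nat.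
      rewrite ger0_norm ?subr_ge0 ?ler_nat ?(ltnW lij)//.
      by rewrite lerBrDr addrC natr1 ler_nat.
    by move=> h; nra.
rewrite card_ord lee_fin powR_ratio//.
have -> : (theta - 1) * (1 - e) = (theta + k) - 1 by rewrite /k; ring.
rewrite -powR_div_self// -/delta.
by apply: le_trans (ltW n2); rewrite le_eqVlt; apply/orP; left; apply/eqP; field; rewrite gt_eqF.
Qed.

End holder_graph.

(** Constancy to the left of [1] makes the limit exist, so [lim] does not take its default value. *)
Lemma quasi_assouad_dim_near (R : realType) d (F : set 'rV[R]_d) (l : \bar R)
    (t0 : R) : t0 < 1 ->
  (forall theta, t0 < theta < 1 -> assouad_spectrum theta F = l) ->
  quasi_assouad_dim F = l.
Proof.
move=> t01 Fl; apply: lim_near_cst; first exact: ereal_hausdorff.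
near=> theta; apply: Fl; apply/andP; split; last by [].
near: theta; exact: nbhs_left_gt.
Unshelve. all: by end_near. Qed.

(* Above each interval [k r, (k+1) r] within [0, s] the graph of [f] meets every
   height of [v - s, v + s]. *)
Definition fills {R : realType} (f : {i01 R} -> R) (s r : R) : Prop :=
  exists v : R, forall k : nat, k.+1%:R * r <= s -> forall y, `|y - v| <= s ->
    exists2 x : {i01 R}, k%:R * r <= x%:num <= k.+1%:R * r & f x = y.

(** * From oscillation at small scales to spectrum 2 *)

Section fills.
Context {R : realType}.
Implicit Type f : {i01 R} -> R.

(** Since [r^theta <= r^ts], the filled window covers the ball of radius [d = r^theta] about a point
    of height [v]. A square array of points with about [d / (20 * r)] rows and columns is picked
    there. *)
Lemma fills_spectrum_ge2 f (ts theta : R) : 0 < ts -> ts <= theta < 1 ->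
  (forall e, 0 < e -> exists2 r, 0 < r < e & fills f (r `^ ts) r) ->
  (2%:E <= assouad_spectrum theta (graph f))%E.
Proof.
move=> ts0 /andP[tst t1] Hf.
apply: (@le_assouad_spectrum _ _ _ _ _ (20^-1 ^+ 2)) => // r0 r00.
have [r1 r10 Kr] : exists2 r1 : R, 0 < r1 & forall r, 0 < r -> r < r1 ->
    r `^ (1 - theta) < 1 / 4.
  by apply: powR_lt_near0; lra.
have m0 : 0 < Num.min (Num.min r0 r1) 1 by rewrite !lt_min r00 r10 ltr01.
have [r /andP[rgt0]] := Hf _ m0.
rewrite !lt_min -andbA => /and3P[rr0 rr1 rlt1] [v vP].
have r01 : 0 < r < 1 by rewrite rgt0.
set d := r `^ theta; have d0 : 0 < d by exact: powR_gt0.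
have ds : d <= r `^ ts by apply: ger_powR; rewrite ?rgt0 ?(ltW rlt1).
have rd : 4 * r <= d.
  have -> : r = r `^ (1 - theta) * d.
    by rewrite -powRD_gt0// subrK powRr1// ltW.
  by have := Kr _ rgt0 rr1; nra.
(* The centre of the ball: the point of height [v] above the first interval, which fits because
   [4 * r <= d]. *)
have [x0 x0P fx0] : exists2 x : {i01 R}, 0%:R * r <= x%:num <= 1%:R * r & f x = v.
  by apply: vP; rewrite ?subrr ?normr0 ?powR_ge0// mul1r; lra.
exists r, (graph_pt f x0); split => //; first exact: graph_ptP.
pose n := Num.truncn (d / (20 * r)).
have r20 : 0 < 20 * r by rewrite mulr_gt0.
have /truncn_itv/andP[n1 n2] : 0 <= d / (20 * r) by rewrite divr_ge0// ltW.
rewrite -/n ler_pdivlMr// in n1; rewrite -/n ltr_pdivrMr// in n2.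
have ordR (i : 'I_n.+1) : 0 <= (i%:R : R) * r /\ 20 * ((i%:R : R) * r) <= d.
  split; first by rewrite mulr_ge0// ltW.
  have : (i%:R : R) * r <= n%:R * r by rewrite ler_pM2r// ler_nat -ltnS.
  by move: n1; lra.
(* Only every fourth interval is used: abscissae in distinct ones differ by at least [4 * r - r].
   Heights in steps of [3 * r] separate the points above one interval. *)
have /choice[g gP] : forall p : 'I_n.+1 * 'I_n.+1, exists x : {i01 R},
    ((4 * p.1)%N%:R * r <= x%:num <= (4 * p.1).+1%:R * r) /\
    f x = v + 3 * (p.2%:R * r).
  move=> [i j] /=; have [i0 i1] := ordR i; have [j0 j1] := ordR j.
  have [||x xP fx] := vP (4 * i)%N _ (v + 3 * (j%:R * r)); last by exists x.
  - by rewrite -natr1 natrM; lra.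
  - by rewrite addrC addKr ger0_norm; lra.
have gx (p : 'I_n.+1 * 'I_n.+1) : 4 * (p.1%:R * r) <= (g p)%:num <= 4 * (p.1%:R * r) + r.
  by have [+ _] := gP p; rewrite -(natr1 (4 * _)) natrM; lra.
apply: (@le_trans _ _ ((#|(('I_n.+1 * 'I_n.+1)%type : finType)|%:R : R)%:E)); last first.
  apply: (@le_packing_number _ _ _ (fun p => graph_pt f (g p))).
  - exact: ltW.
  - move=> p; split; last exact: graph_ptP.
    apply: le_lt_trans (edist_graph_pt _ _ _) _.
    rewrite fx0 (gP p).2 opprD addrA subrr sub0r normrN.
    have [i0 i1] := ordR p.1; have [j0 j1] := ordR p.2.
    rewrite (@ger0_norm _ (3 * _)); last by rewrite mulr_ge0.
    have : `|x0%:num - (g p)%:num| <= d / 5 + r.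
      have := gx p; move: x0P; rewrite mul0r mul1r ler_norml; lra.
    by rewrite -/d; move: rd d0; lra.
  - move=> [i j] [i' j'] neq.
    have far (a b : 'I_n.+1) : a != b -> r <= `|a%:R * r - b%:R * r|.
      move=> ab; rewrite -mulrBl normrM (gtr0_norm rgt0) ler_peMl ?(ltW rgt0)//.
      have [lab|lab|eab] := ltngtP a b; last by move: ab; rewrite -val_eqE/= eab eqxx.
        rewrite distrC ger0_norm ?subr_ge0 ?ler_nat ?(ltnW lab)//.
        by rewrite lerBrDr addrC natr1 ler_nat.
      rewrite ger0_norm ?subr_ge0 ?ler_nat ?(ltnW lab)//.
      by rewrite lerBrDr addrC natr1 ler_nat.
    have [ii|ii] := eqVneq i i'.
      exists ord_max; rewrite !graph_pt1 (gP _).2 (gP _).2 /=.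
      have jj : j != j' by apply: contra neq => /eqP <-; rewrite ii.
      have := far _ _ jj.
      have -> : v + 3 * (j%:R * r) - (v + 3 * (j'%:R * r)) =
        3 * (j%:R * r - j'%:R * r) by ring.
      by rewrite normrM ger0_norm//; lra.
    exists ord0; rewrite !graph_pt0.
    have := far _ _ ii; have := gx (i, j); have := gx (i', j') => /=.
    set a := i%:R * r; set b := i'%:R * r => h1 h2.
    by rewrite ler_normr ltr_normr => /orP[] h; apply/orP; [left|right]; lra.
rewrite card_prod card_ord lee_fin powR_mulrn ?divr_ge0 ?(ltW d0) ?(ltW rgt0)//.
have n3 : d / r <= 20 * n.+1%:R.
  by rewrite ler_pdivrMr//; move: n2; lra.
have X0 : 0 <= d / r by rewrite divr_ge0 ?ltW.
have n4 : 20^-1 * (d / r) <= n.+1%:R.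
  by rewrite mulrC ler_pdivrMr// [leRHS]mulrC.
rewrite -exprMn natrM -expr2; apply: lerXn2r => //; rewrite nnegrE//.
by rewrite mulr_ge0// invr_ge0.
Qed.

Lemma cos_pi_nat (k : nat) : cos (pi *+ k) = (-1) ^+ k :> R.
Proof.
by rewrite -[pi *+ k]add0r (alternatingn (@cosDpi R)) cos0 mulr1.
Qed.

(** At consecutive multiples of [r] the cosine is [1] and [-1] in some order, so [f] is at least
    [v + A / 2] at one end and at most [v - A / 2] at the other. The intermediate value theorem
    gives all heights between. *)
Lemma fills_of_cos f (v A s r : R) : 0 < r -> s <= 1 -> s <= A / 2 ->
  continuous (f \o clamp01) ->
  (forall x : {i01 R}, x%:num <= s ->
    `|f x - (v + A * cos (pi * (x%:num / r)))| <= A / 2) ->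
  fills f s r.
Proof.
move=> r0 s1 sA cf fc; exists v => k ks y yv.
have k0 : 0 <= k%:R * r by rewrite mulr_ge0// ltW.
have kk : k%:R * r <= k.+1%:R * r by rewrite ler_pM2r// ler_nat.
have fk (m : nat) : 0 <= m%:R * r -> m%:R * r <= s ->
    `|f (clamp01 (m%:R * r)) - (v + A * (-1) ^+ m)| <= A / 2.
  move=> m0 ms; have := fc (clamp01 (m%:R * r)).
  rewrite clamp01E; last by rewrite m0 (le_trans ms).
  by rewrite mulfK ?gt_eqF// mulr_natr cos_pi_nat; apply.
have f1 := fk k k0 (le_trans kk ks); have f2 := fk k.+1 (le_trans k0 kk) ks.
have : Num.min ((f \o clamp01) (k%:R * r)) ((f \o clamp01) (k.+1%:R * r)) <= y <=
       Num.max ((f \o clamp01) (k%:R * r)) ((f \o clamp01) (k.+1%:R * r)).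
  have y1 := le_trans yv sA; rewrite /= ge_min le_max.
  move: y1 f1 f2; rewrite exprS -signr_odd !ler_norml.
  set a := f _; set b := f _.
  by case: (odd k) => /= y1 f1 f2; apply/andP; split; apply/orP;
    rewrite ?expr1 ?expr0 in f1 f2; [left|right|right|left]; lra.
move/(@IVT R (f \o clamp01) _ _ y kk) => []; first exact: continuous_subspaceT.
move=> c; rewrite in_itv/= => /andP[c0 c1] fcy; exists (clamp01 c) => //.
by rewrite clamp01E ?c0 ?c1//; apply/andP; split; lra.
Qed.

Lemma cos_dist (a b : R) : `|cos a - cos b| <= `|a - b|.
Proof.
wlog ab : a b / a <= b.
  by move=> H; have [/H//|/ltW/H] := leP a b; rewrite distrC [leRHS]distrC.
rewrite distrC; have [c _ ->] : exists2 c, c \in `[a, b] & cos b - cos a = - sin c * (b - a).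
  apply: MVT_segment => //.
  by apply: continuous_subspaceT; exact: continuous_cos.
have s1 : `|sin c| <= 1 by rewrite ler_norml sin_geN1 sin_le1.
rewrite normrM normrN [leRHS]distrC ler_piMl//.
Qed.

End fills.

(** * Density of functions whose graphs fill at small scales *)

Section dense_fills.
Context {R : realType} (omega : modulus R) (omega_concave : concave01 omega).

Let w t := fine (omega t).
Let w_ge0 := @fine_modulus_ge0 R omega.
Let w_homo := fine_modulus_homo omega_concave.

Let w_le1 (x y : {i01 R}) : w `|x%:num - y%:num| <= w 1.
Proof. by have /andP[h0 h1] := i01_dist x y; exact: w_homo. Qed.

Let w_le (x y x' y' : {i01 R}) :
  `|x%:num - y%:num| <= `|x'%:num - y'%:num| ->
  w `|x%:num - y%:num| <= w `|x'%:num - y'%:num|.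
Proof. by move=> h; apply: w_homo => //; case/andP: (i01_dist x' y'). Qed.

Lemma little_holder_continuous (f : {i01 R} -> R) :
  little_holder_space omega f -> continuous (f \o clamp01).
Proof.
move=> /(little_holder_spaceP omega_concave)[_ fl] t.
apply/cvgrPdist_lt => e e0.
have w1 : 0 <= w 1 by apply: w_ge0; rewrite ler01 lexx.
(* As [w] is bounded by [w 1], this small constant bounds the increment strictly by [e]. *)
have e'0 : 0 < e / (1 + w 1) by rewrite divr_gt0// ltr_wpDr.
have [d /andP[d0 _] fd] := fl _ e'0.
near=> u => /=.
have tu : `|t - u| < d by near: u; apply: cvgr_dist_lt.
have := fd (clamp01 t) (clamp01 u) (le_trans (clamp01_dist _ _) (ltW tu)).
move/le_lt_trans; apply.
apply: (@le_lt_trans _ _ (e / (1 + w 1) * w 1)).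
  by rewrite ler_wpM2l ?(ltW e'0)// w_le1.
by rewrite -mulrA gtr_pMr// mulrC ltr_pdivrMr ?mul1r ?ltrDr// ltr_wpDr.
Unshelve. all: by end_near. Qed.

(** The seminorm of the wave is bounded independently of [r]. At distances [u >= r], the cosine
    varies by at most [2] and [w r <= w u]; below [r], the Lipschitz bound [4 * (u / r)] meets
    [u / r * w r <= w u]. *)
Lemma concave_scaled_cos (c r : R) (x y : {i01 R}) : 0 <= c -> 0 < r <= 1 ->
  `|c * w r * cos (pi * (x%:num / r)) - c * w r * cos (pi * (y%:num / r))| <=
  4 * c * w `|x%:num - y%:num|.
Proof.
move=> c0 /andP[r0 r1].
have wr0 : 0 <= w r by apply: w_ge0; rewrite (ltW r0) r1.
rewrite -mulrBr normrM (ger0_norm (mulr_ge0 c0 wr0)).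
have /andP[u0 u1] := i01_dist x y.
set u := `|_ - _| in u0 u1 *.
have -> : 4 * c * w u = c * (4 * w u) by ring.
rewrite -mulrA ler_wpM2l//.
have [ru|ur] := leP r u.
  have : w r <= w u by apply: w_homo => //; exact: ltW.
  have : `|cos (pi * (x%:num / r)) - cos (pi * (y%:num / r))| <= 2.
    apply: le_trans (ler_normB _ _) _.
    have h z : `|cos z : R| <= 1 by rewrite ler_norml cos_geN1 cos_le1.
    by have := h (pi * (x%:num / r)); have := h (pi * (y%:num / r)); lra.
  set q := `|_ - _|; have q0 : 0 <= q by exact: normr_ge0.
  by nra.
have h1 : `|cos (pi * (x%:num / r)) - cos (pi * (y%:num / r))| <= 4 * (u / r).
  apply: le_trans (cos_dist _ _) _.
  rewrite -mulrBr -mulrBl !normrM (@ger0_norm _ pi) ?pi_ge0//.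
  rewrite (@gtr0_norm _ r^-1) ?invr_gt0// ler_wpM2r//.
    by rewrite mulr_ge0// invr_ge0 ltW.
  by have := @pihalf_lt2 R; lra.
have h2 : u / r * w r <= w u.
  by apply: fine_modulus_ratio => //; [exact: ltW|rewrite r0].
by have := ler_wpM2l wr0 h1; lra.
Qed.

Variables (a ts : R).
Hypotheses (a01 : 0 < a < 1) (ats : a < ts).
Variable t0 : R.
Hypothesis (t00 : 0 < t0).
Hypothesis w_ge_powR : forall t, 0 < t -> t < t0 -> t <= 1 -> t `^ a <= w t.

(* The perturbation: [f0] is frozen to a constant on [0, delta], and a cosine
   wave of wavelength [2 r] and amplitude [c * w r] is added. *)
Let bump (f0 : {i01 R} -> R) (delta c r : R) (x : {i01 R}) : R :=
  f0 (clamp01 (Num.max x%:num delta)) + c * w r * cos (pi * (x%:num / r)).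

Let max_dist (s t d : R) : `|Num.max s d - Num.max t d| <= `|s - t|.
Proof.
have : - `|s - t| <= s - t <= `|s - t| by rewrite -ler_norml.
rewrite ler_norml /Order.max.
by do !case: ifPn; rewrite -?leNgt; lra.
Qed.

Let bump_dist f0 delta c r (x y : {i01 R}) :
  `|bump f0 delta c r x - bump f0 delta c r y| <=
  `|f0 (clamp01 (Num.max x%:num delta)) - f0 (clamp01 (Num.max y%:num delta))| +
  `|c * w r * cos (pi * (x%:num / r)) - c * w r * cos (pi * (y%:num / r))|.
Proof. by rewrite /bump opprD addrACA; exact: ler_normD. Qed.

Let clamp_max_dist delta (x y : {i01 R}) :
  `|(clamp01 (Num.max x%:num delta))%:num -
    (clamp01 (Num.max y%:num delta))%:num| <= `|x%:num - y%:num|.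
Proof. exact: le_trans (clamp01_dist _ _) (max_dist _ _ _). Qed.

Lemma bump_little_holder f0 delta c r : 0 <= c -> 0 < r <= 1 ->
  little_holder_space omega f0 -> little_holder_space omega (bump f0 delta c r).
Proof.
move=> c0 r01 /(little_holder_spaceP omega_concave)[+ fl].
move=> /(holder_spaceP omega_concave)[M M0 fM].
have /andP[r0 r1] := r01.
apply/(little_holder_spaceP omega_concave); split.
  apply/(holder_spaceP omega_concave); exists (M + 4 * c).
    by rewrite addr_ge0// mulr_ge0.
  move=> x y; apply: le_trans (bump_dist _ _ _ _ _ _) _.
  rewrite [leRHS]mulrDl; apply: lerD; last exact: concave_scaled_cos.
  apply: le_trans (fM _ _) _; rewrite ler_wpM2l//.
  by apply: w_le; exact: clamp_max_dist.
move=> e e0.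
have e2 : 0 < e / 2 by rewrite divr_gt0.
have [d /andP[d0 d1] fd] := fl _ e2.
pose L := c * w r * (4 / r).
have wr0 : 0 <= w r by apply: w_ge0; rewrite (ltW r0) r1.
have L0 : 0 <= L by rewrite !mulr_ge0// invr_ge0 ltW.
have [t1 t10 Lt] : exists2 t1 : R, 0 < t1 & forall t, 0 < t -> t < t1 ->
    t `^ (1 - a) < e / (2 * (1 + L)).
  apply: powR_lt_near0; first by case/andP: a01; lra.
  by rewrite divr_gt0// mulr_gt0// ltr_wpDr.
have m0 : 0 < Num.min (Num.min d t0) t1 by rewrite !lt_min d0 t00 t10.
pose m := Num.min (Num.min d t0) t1 / 2.
have : m < Num.min (Num.min d t0) t1 by rewrite /m; lra.
rewrite !lt_min -andbA => /and3P[md mt0 mt1].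
exists m; first by rewrite /m; apply/andP; split; [lra|move: md; rewrite /m; lra].
move=> x y; set u := `|_ - _| => um.
have /andP[u0 u1] := i01_dist x y; rewrite -/u in u0 u1.
apply: le_trans (bump_dist _ _ _ _ _ _) _.
have -> : e * fine (omega u) = e / 2 * w u + e / 2 * w u by rewrite /w; field.
apply: lerD.
  apply: le_trans (fd _ _ _) _.
    by apply: le_trans (clamp_max_dist _ _ _) _; rewrite -/u; lra.
  rewrite ler_wpM2l// ?divr_ge0 ?(ltW e0)//.
  by apply: w_le; exact: clamp_max_dist.
apply: (@le_trans _ _ (L * u)).
  rewrite -mulrBr normrM (ger0_norm (mulr_ge0 c0 wr0)) /L -!mulrA.
  rewrite ler_wpM2l// ler_wpM2l//.
  apply: le_trans (cos_dist _ _) _.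
  rewrite -mulrBr -mulrBl !normrM (@ger0_norm _ pi) ?pi_ge0//.
  rewrite (@gtr0_norm _ r^-1) ?invr_gt0// -/u [r^-1 * u]mulrC ler_wpM2r//.
    by rewrite mulr_ge0// invr_ge0 ltW.
  by have := @pihalf_lt2 R; lra.
have [u_eq0|un0] := eqVneq u 0.
  by rewrite u_eq0 mulr0 mulr_ge0 ?divr_ge0 ?(ltW e0)// w_ge0// lexx ler01.
have ugt0 : 0 < u by rewrite lt_def un0.
have -> : u = u `^ (1 - a) * u `^ a.
  by rewrite -powRD_gt0// subrK powRr1.
have h1 := Lt u ugt0 (le_lt_trans um mt1).
have h2 := w_ge_powR ugt0 (le_lt_trans um mt0) u1.
rewrite mulrA -powRD_gt0// subrK powRr1//.
apply: ler_pM => //; [by rewrite mulr_ge0// powR_ge0|exact: powR_ge0|].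
rewrite ltr_pdivlMr ?mulr_gt0 ?ltr_wpDr// in h1.
by have := powR_ge0 u (1 - a); nra.
Qed.

Let min_dist (s t d : R) :
  `|Num.min s d - Num.min t d| <= `|s - t|.
Proof.
have : - `|s - t| <= s - t <= `|s - t| by rewrite -ler_norml.
rewrite ler_norml /Order.min.
by do !case: ifPn; rewrite -?leNgt; lra.
Qed.

Let min_dist_le (s t d : R) : 0 <= s -> 0 <= t -> 0 <= d ->
  `|Num.min s d - Num.min t d| <= d.
Proof.
move=> s0 t0' d0; rewrite ler_norml /Order.min.
by do !case: ifPn; rewrite -?leNgt; lra.
Qed.

(** Turns the error of freezing into an increment between points truncated at [delta], where only
    the local seminorm matters. *)
Lemma frozen_diffE (f : {i01 R} -> R) (delta : R) (x : {i01 R}) :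
  f x - f (clamp01 (Num.max x%:num delta)) =
  f (clamp01 (Num.min x%:num delta)) - f (clamp01 delta).
Proof.
rewrite /Order.min /Order.max; case: ifPn => _; rewrite clamp01_num//.
by rewrite !subrr.
Qed.

(** Truncation brings any two points within [delta] of each other, so the local bound becomes
    global. *)
Lemma frozen_diff_dist (f : {i01 R} -> R) (delta c : R) : 0 < delta -> 0 <= c ->
  (forall x y : {i01 R}, `|x%:num - y%:num| <= delta ->
    `|f x - f y| <= c * w `|x%:num - y%:num|) ->
  forall x y : {i01 R},
  `|f (clamp01 (Num.min x%:num delta)) - f (clamp01 (Num.min y%:num delta))| <=
  c * w `|x%:num - y%:num|.
Proof.
move=> d0 c0 fd x y.
have /andP[x0 _] := i01_itv x; have /andP[y0 _] := i01_itv y.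
apply: le_trans (fd _ _ _) _.
  by apply: le_trans (clamp01_dist _ _) _; apply: min_dist_le => //; exact: ltW.
rewrite ler_wpM2l//; apply: w_le.
exact: le_trans (clamp01_dist _ _) (min_dist _ _ _).
Qed.

(** Freezing and wave each cost [c * w 1] in sup norm; in the seminorm they cost [c] and [4 * c]. *)
Lemma bump_dist_le (f0 G : little_holder omega) (delta c r : R) :
  0 < delta <= 1 -> 0 <= c -> 0 < r <= 1 ->
  (forall x y : {i01 R}, `|x%:num - y%:num| <= delta ->
    `|val f0 x - val f0 y| <= c * w `|x%:num - y%:num|) ->
  (forall x, val G x = bump (val f0) delta c r x) ->
  little_holder_dist f0 G <= 2 * (c * w 1) + 5 * c.
Proof.
move=> /andP[d0 d1] c0 r01 fd Gv.
have pd := frozen_diff_dist d0 c0 fd.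
have /andP[r0 r1] := r01.
have wr0 : 0 <= w r by apply: w_ge0; rewrite (ltW r0).
have wr1 : w r <= w 1 by apply: w_homo => //; exact: ltW.
have f0G x : val f0 x - val G x = val f0 (clamp01 (Num.min x%:num delta)) -
    val f0 (clamp01 delta) - c * w r * cos (pi * (x%:num / r)).
  by rewrite Gv /bump opprD addrA frozen_diffE.
apply: (little_holder_dist_le omega_concave) => [x|x y]; rewrite !f0G.
  rewrite mulr_natl mulr2n.
  apply: le_trans (ler_normB _ _) _; apply: lerD.
    have -> : clamp01 delta = clamp01 (Num.min (1%:i01 : {i01 R})%:num delta).
      by rewrite min_r.
    by apply: le_trans (pd _ _) _; rewrite ler_wpM2l// w_le1.
  have cw0 : 0 <= c * w r by rewrite mulr_ge0.
  rewrite normrM (ger0_norm cw0).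
  apply: (@le_trans _ _ (c * w r)); last by rewrite ler_wpM2l.
  by rewrite ler_piMr// ler_norml cos_geN1 cos_le1.
have -> (p q z u v : R) : p - z - u - (q - z - v) = (p - q) - (u - v) by ring.
apply: le_trans (ler_normB _ _) _.
have -> : 5 * c = c + 4 * c by ring.
by rewrite [leRHS]mulrDl; apply: lerD; [exact: pd|exact: concave_scaled_cos].
Qed.

Lemma dense_fills (f0 : little_holder omega) (e r0 : R) : 0 < e -> 0 < r0 ->
  exists r (e' : R) (G : little_holder omega),
    [/\ 0 < r < r0, 0 < e', little_holder_dist f0 G < e &
      forall f : little_holder omega, little_holder_dist G f < e' ->
        fills (val f) (r `^ ts) r].
Proof.
move=> e0 r00.
have f0P : little_holder_space omega (val f0) by have := valP f0; rewrite inE.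
have w1 : 0 <= w 1 by apply: w_ge0; rewrite ler01 lexx.
(* Makes the total cost [2 * (c * w 1) + 5 * c] smaller than [e]. *)
pose c := e / (8 * (1 + w 1)).
have c0 : 0 < c by rewrite divr_gt0// mulr_gt0// ltr_wpDr.
have ce : e = c * (8 * (1 + w 1)).
  by rewrite /c divfK// gt_eqF// mulr_gt0// ltr_wpDr.
have [_ /(_ c c0)[delta d1 fd]] :=
  (little_holder_spaceP omega_concave _).1 f0P.
have /andP[d0 dle1] := d1.
have ts0 : 0 < ts by case/andP: a01 => a0 _; exact: lt_trans ats.
have [r1 r10 Kr1] := powR_lt_near0 ts0 d0.
have [r2 r20 Kr2] : exists2 t1 : R, 0 < t1 & forall t, 0 < t -> t < t1 ->
    t `^ (ts - a) < c / 2.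
  by apply: powR_lt_near0; rewrite ?subr_gt0// divr_gt0.
have m0 : 0 < Num.min (Num.min (Num.min (Num.min r0 t0) r1) r2) 1.
  by rewrite !lt_min r00 t00 r10 r20 ltr01.
have [r [rgt0]] : exists r, 0 < r /\
    r < Num.min (Num.min (Num.min (Num.min r0 t0) r1) r2) 1.
  by exists (Num.min (Num.min (Num.min (Num.min r0 t0) r1) r2) 1 / 2); split; lra.
rewrite !lt_min -!andbA => /and5P[rr0 rt0 rr1 rr2 rlt1].
have r01 : 0 < r <= 1 by rewrite rgt0 ltW.
have sd := ltW (Kr1 _ rgt0 rr1).
have wr := w_ge_powR rgt0 rt0 (ltW rlt1).
have wr0 : 0 < w r by apply: lt_le_trans wr; exact: powR_gt0.
(* The amplitude beats the window: [r^ts = r^(ts - a) * r^a], with [r^(ts - a) < c / 2] and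
   [r^a <= w r]. *)
have sA : r `^ ts <= c * w r / 2.
  have -> : ts = (ts - a) + a by ring.
  rewrite powRD_gt0//; have := Kr2 _ rgt0 rr2.
  by have := powR_gt0 a rgt0; nra.
have GP := bump_little_holder delta (ltW c0) r01 f0P.
pose G : little_holder omega :=
  exist (fun f => f \in little_holder_space omega) _ (mem_set GP).
have Gv x : val G x = bump (val f0) delta c r x by [].
(* Half the amplitude is the uniform error that [fills_of_cos] tolerates, and the distance dominates
   the uniform one. *)
exists r, (c * w r / 2), G; split => //.
- by rewrite rgt0.
- by rewrite divr_gt0// mulr_gt0.
- apply: le_lt_trans (bump_dist_le d1 (ltW c0) r01 fd Gv) _.
  have -> : e = 2 * (c * w 1) + 5 * c + (6 * (c * w 1) + 3 * c).
    by rewrite ce; ring.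
  have cw0 : 0 <= 6 * (c * w 1).
    by rewrite mulr_ge0// mulr_ge0// ltW.
  by rewrite ltrDl ltr_wpDl// mulr_gt0.
- move=> f Gf.
  have fP : little_holder_space omega (val f) by have := valP f; rewrite inE.
  apply: (@fills_of_cos _ _ (val f0 (clamp01 delta)) (c * w r)) => //.
  + exact: le_trans sd dle1.
  + exact: little_holder_continuous.
  move=> x xs; have := little_holder_dist_ge G f x.
  have xd := le_trans xs sd.
  rewrite Gv /bump max_r// distrC => h.
  exact: le_trans h (ltW Gf).
Qed.

End dense_fills.

(** Every ball contains a ball inside [A], which misses [B]. Subsets of the complement are allowed
    because [meagre] asks for equality with a union, not inclusion. *)
Lemma nowhere_dense_sub_compl (R : realType) (M : metricType R) (A B : set M) :
  B `<=` ~` A ->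
  (forall x e, 0 < e -> exists y (d : R), [/\ 0 < d, mdist x y < e &
     forall z, mdist y z < d -> A z]) ->
  nowhere_dense B.
Proof.
move=> BA dA; apply/seteqP; split=> // x /nbhs_ballP[e /= e0 xe].
have [y [d [d0 xy yA]]] := dA x e e0.
have /(_ (ball y d) (nbhsx_ballx y d d0)) : closure B y.
  by apply: xe; rewrite ballEmdist.
by move=> [z [/BA Az]]; rewrite ballEmdist => /yA.
Qed.

Lemma at_right0_interval (R : realType) (P : set R) : (0 : R)^'+ P ->
  exists2 t0 : R, 0 < t0 & forall t, 0 < t -> t < t0 -> P t.
Proof.
move=> /nbhs_ballP[e /= e0 eP]; exists e => // t t0 te.
by apply: eP => //=; rewrite /ball/= sub0r normrN gtr0_norm.
Qed.

(** * Comparison of the modulus with powers of [t] *)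

Section exponent.
Context {R : realType} {omega : modulus R} {eta : \bar R}.
Hypothesis omega_concave : concave01 omega.
Hypothesis omega_eta : (lne (omega t) / (ln t)%:E)%E @[t --> 0^'+] --> eta.

Lemma log_ratioE (t : R) : 0 < t < 1 -> (lne (omega t) / (ln t)%:E)%E =
  (ln (fine (omega t)) / ln t)%:E.
Proof.
move=> /andP[t0 t1]; rewrite (modulus_fineK omega_concave) ?(ltW t0) ?(ltW t1)//.
rewrite lne_EFin ?(fine_modulus_gt0 omega_concave) ?t0 ?(ltW t1)//.
by rewrite inver lt_eqF// ln_lt0// t0.
Qed.

(** As [ln t < 0] near [0], a quotient of logarithms below [a] means [ln (w t) > a * ln t]. *)
Lemma modulus_ge_powR_near0 (a : R) : (eta < a%:E)%E ->
  exists2 t0 : R, 0 < t0 &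
    forall t, 0 < t -> t < t0 -> t <= 1 -> t `^ a <= fine (omega t).
Proof.
move=> eta_a.
have /omega_eta/at_right0_interval[t1 t10 t1P] : nbhs eta [set y | (y < a%:E)%E].
  by apply: open_nbhs_nbhs; split => //; exact: open_ereal_lt_ereal.
exists (Num.min t1 1); first by rewrite lt_min t10 ltr01.
move=> t t0; rewrite lt_min => /andP[tt1 tlt1] _.
have t01 : 0 < t < 1 by rewrite t0.
have := t1P t t0 tt1; rewrite /= log_ratioE// lte_fin.
rewrite ltr_ndivrMr ?ln_lt0// -ln_powR => h; apply: ltW.
by rewrite -ltr_ln// posrE ?powR_gt0// (fine_modulus_gt0 omega_concave)// t0 ltW.
Qed.

Lemma modulus_le_powR (a : R) : 0 < a -> (a%:E < eta)%E ->
  exists2 K : R, 0 < K & forall t, 0 <= t <= 1 -> fine (omega t) <= K * t `^ a.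
Proof.
move=> a0 eta_a.
have /omega_eta/at_right0_interval[t1 t10 t1P] : nbhs eta [set y | (a%:E < y)%E].
  by apply: open_nbhs_nbhs; split => //; exact: open_ereal_gt_ereal.
pose t2 := Num.min t1 1.
have t20 : 0 < t2 by rewrite lt_min t10 ltr01.
pose w1 := fine (omega 1).
have w10 : 0 < w1 by apply: (fine_modulus_gt0 omega_concave); rewrite ltr01 lexx.
(* The summand [1] serves below [t2], where the limit controls the modulus; the other serves above
   [t2], by monotonicity. *)
exists (1 + w1 / t2 `^ a); first by rewrite ltr_wpDr// divr_ge0 ?powR_ge0// ltW.
move=> t /andP[]; rewrite le_eqVlt => /predU1P[<- _|t0 tle1].
  by rewrite (modulus0 (modulusP omega)) powR0 ?mulr0// gt_eqF.
have [t2t|] := leP t2 t.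
  apply: (@le_trans _ _ w1); first by apply: (fine_modulus_homo omega_concave) => //; exact: ltW.
  apply: (@le_trans _ _ (w1 / t2 `^ a * t `^ a)).
    rewrite mulrAC ler_pdivlMr ?powR_gt0// ler_pM2l//.
    by apply: ge0_ler_powR; rewrite ?nnegrE ?(ltW a0) ?(ltW t20) ?(ltW t0).
  by rewrite ler_wpM2r ?powR_ge0// lerDr.
rewrite lt_min => /andP[tt1 tlt1].
have t01 : 0 < t < 1 by rewrite t0.
have := t1P t t0 tt1; rewrite /= log_ratioE// lte_fin.
rewrite ltr_ndivlMr ?ln_lt0// -ln_powR => h.
apply: (@le_trans _ _ (t `^ a)).
  by apply: ltW; rewrite -ltr_ln// posrE ?powR_gt0// (fine_modulus_gt0 omega_concave)// t0 ltW.
by rewrite ler_peMl ?powR_ge0// lerDl divr_ge0 ?powR_ge0// ltW.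
Qed.

Lemma holder_space_powR (f : {i01 R} -> R) (a : R) : 0 < a -> (a%:E < eta)%E ->
  holder_space omega f -> exists2 K : R, 0 < K &
  forall x y : {i01 R}, `|f x - f y| <= K * `|x%:num - y%:num| `^ a.
Proof.
move=> a0 eta_a /(holder_spaceP omega_concave)[M M0 fM].
have [K K0 wK] := modulus_le_powR a0 eta_a.
exists ((M + 1) * K); first by rewrite mulr_gt0// ltr_wpDl.
move=> x y; apply: le_trans (fM x y) _.
apply: (@le_trans _ _ (M * (K * `|x%:num - y%:num| `^ a))).
  by rewrite ler_wpM2l// wK// i01_dist.
by rewrite -mulrA ler_wpM2r ?lerDl// mulr_ge0 ?powR_ge0// ltW.
Qed.

End exponent.

Theorem corollary2p4 (R : realType) (omega : modulus R) (eta : \bar R)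
    (omega_concave : concave01 omega)
    (omega_eta : (lne (omega t) / (ln t)%:E)%E @[t --> 0^'+] --> eta) :
  ((1 <= eta)%E ->
    forall f : {i01 R} -> R, holder_space omega f ->
      quasi_assouad_dim (graph f) = 1%E) /\
  ((eta < 1)%E ->
    typical (fun f : little_holder omega =>
      quasi_assouad_dim (graph (val f)) = 2%:E)).
Proof.
split=> [eta1 f fw|eta1].
  apply: (@quasi_assouad_dim_near _ _ _ _ 0) => // theta /andP[t0 t1].
  have fH a : 0 < a < 1 -> exists2 K : R, 0 < K &
      forall x y : {i01 R}, `|f x - f y| <= K * `|x%:num - y%:num| `^ a.
    move=> /andP[a0 a1]; apply: (holder_space_powR omega_concave omega_eta) => //.
    by apply: lt_le_trans eta1; rewrite lte_fin.
  apply/eqP; rewrite eq_le holder_graph_spectrum_le1//=.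
  by rewrite holder_graph_spectrum_ge1// t0.
(* For real [eta], the midpoint of [max eta 0] and [1]; for [-oo], the value [1 / 2]. *)
have [a a01 eta_a] : exists2 a : R, 0 < a < 1 & (eta < a%:E)%E.
  case: eta eta1 {omega_eta} => [z| |]//=; rewrite ?lte_fin => z1; last first.
    by exists (1 / 2); [lra|exact: ltNyr].
  exists ((Num.max z 0 + 1) / 2); rewrite ?lte_fin /Order.max; case: ifPn;
    rewrite -?leNgt; lra.
have [t0 t00 wa] := modulus_ge_powR_near0 omega_concave omega_eta eta_a.
pose ts := (1 + a) / 2.
have ats : a < ts by rewrite /ts; case/andP: a01; lra.
have ts1 : ts < 1 by rewrite /ts; case/andP: a01; lra.
have ts0 : 0 < ts by case/andP: a01 => a0 _; exact: lt_trans ats.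
pose A (n : nat) := [set f : little_holder omega |
  exists2 r : R, 0 < r < n.+1%:R^-1 & fills (val f) (r `^ ts) r].
pose P := [set f : little_holder omega | quasi_assouad_dim (graph (val f)) = 2%:E].
(* A function in every [A n] fills at arbitrarily small scales and so lies in [P]. Hence the
   complement of [P] is exactly the union of its parts outside the sets [A n]. *)
exists (fun n => ~` P `&` ~` A n); last first.
  apply/seteqP; split => [f Pf|f [n _ []]//].
  apply: contrapT => nA; apply: (Pf).
  have fA n : A n f.
    by apply: contrapT => An; apply: nA; exists n => //; split.
  apply: (@quasi_assouad_dim_near _ _ _ _ ts) => // theta /andP[tst t1].
  apply/eqP; rewrite eq_le assouad_spectrum_le2//=.
  apply: (@fills_spectrum_ge2 _ _ ts) => //; first by rewrite ltW.
  (* This index [n] satisfies [1 / (n + 1) < e]. *)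
  move=> e e0; have [r /andP[r0 rn] rf] := fA (Num.truncn e^-1).
  exists r => //; rewrite r0/=; apply: lt_trans rn _.
  by rewrite invf_plt ?posrE// truncnS_gt.
move=> n; apply: (@nowhere_dense_sub_compl _ _ (A n)); first by move=> f [].
move=> f0 e e0.
have n0 : 0 < n.+1%:R^-1 :> R by rewrite invr_gt0.
have [r [d [G [r01 d0 fG GA]]]] :=
  dense_fills omega_concave a01 ats t00 wa f0 e0 n0.
by exists G, d; split => // g Gg; exists r => //; exact: GA.
Qed.
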